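(* If a graph $G$ is $3$-connected and has at least $7$ vertices, then $\operatorname{mmw}(G)\ge 3$.
   Context: All graphs are finite and simple. A graph is $k$-connected if it has at least $k$ vertices and remains connected after deleting any fewer than $k$ vertices. A tree is subcubic if every vertex has degree $1$ or $3$. A branch-decomposition of $V(G)$ is a pair $(T,\mathcal{L})$ with $T$ a subcubic tree and $\mathcal{L}$ a bijection from the leaves of $T$ to $V(G)$; each edge of $T$ induces a partition $(A,B)$ of $V(G)$. $\operatorname{mm}_G(A)$ is the size of a maximum matching among the edges of $G$ with exactly one end in $A$. The width of the decomposition is the maximum of $\operatorname{mm}_G(A)$ over induced partitions, and $\operatorname{mmw}(G)$ (maximum matching width) is the minimum width over all branch-decompositions of $V(G)$. *)

(* Defs.v *)
From mathcomp Require Import all_boot.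
From mathcomp Require Import boolp.

Set Implicit Arguments.
Unset Strict Implicit.
Unset Printing Implicit Defensive.

Record sgraph := SGraph {
  vertex :> finType;
  adj : rel vertex;
  adj_sym : symmetric adj;
  adj_irrefl : irreflexive adj }.

Section Graphs.
Variable G : sgraph.

Definition degree (x : G) : nat := #|[set y | adj x y]|.

Definition connected_graph : Prop :=
  0 < #|G| /\ forall x y : G, connect (@adj G) x y.

(* ucycle also holds of the closed walks [:: x; y] along a single edge, hence
   the bound 2: proper cycles have at least three vertices. *)
Definition acyclic : Prop :=
  forall s : seq G, ucycle (@adj G) s -> size s <= 2.

Definition is_tree : Prop := connected_graph /\ acyclic.

Definition subcubic : Prop :=
  forall x : G, degree x = 1 \/ degree x = 3.

Definition leaf : finType := {x : G | degree x == 1}.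

Definition del_adj (S : {set G}) : rel {x : G | x \notin S} :=
  [rel x y | adj (val x) (val y)].

Lemma del_adj_sym (S : {set G}) : symmetric (@del_adj S).
Proof. by move=> x y; apply: adj_sym. Qed.

Lemma del_adj_irrefl (S : {set G}) : irreflexive (@del_adj S).
Proof. by move=> x; apply: adj_irrefl. Qed.

Definition del_vertices (S : {set G}) : sgraph :=
  SGraph (@del_adj_sym S) (@del_adj_irrefl S).

Definition edges : {set {set G}} :=
  [set E : {set G} | [exists x, exists y, adj x y && (E == [set x; y])]].

Definition cut (A : {set G}) : {set {set G}} :=
  [set E in edges | #|E :&: A| == 1].

Definition mm (A : {set G}) : nat :=
  \max_(M : {set {set G}} | (M \subset cut A) && trivIset M) #|M|.

Definition del_edge (x y : G) : rel G :=
  [rel u v | adj u v && ([set u; v] != [set x; y])].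

End Graphs.

Definition k_connected (k : nat) (G : sgraph) : Prop :=
  k <= #|G| /\
  forall S : {set G}, #|S| < k -> connected_graph (del_vertices S).

Record branch_decomposition (G : sgraph) := BranchDecomposition {
  bd_tree : sgraph;
  bd_is_tree : is_tree bd_tree;
  bd_subcubic : subcubic bd_tree;
  bd_map : leaf bd_tree -> G;
  bd_map_bij : bijective bd_map }.

Section BranchDecompositions.
Variables (G : sgraph) (D : branch_decomposition G).

(* The side containing x of the partition of V(G) induced by the tree edge xy;
   the other side is side y x. *)
Definition side (x y : bd_tree D) : {set G} :=
  [set bd_map l | l : leaf (bd_tree D) & connect (del_edge x y) x (val l)].

Definition width : nat :=
  \max_(x : bd_tree D) \max_(y : bd_tree D | adj x y) mm (side x y).

End BranchDecompositions.

Definition has_width (G : sgraph) (k : nat) : Prop :=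
  exists D : branch_decomposition G, width D = k.

(* The minimum width over all branch-decompositions. The value 0 is used when
   there is none, that is, when G has at most one vertex. *)
Definition mmw (G : sgraph) : nat :=
  if pselect (exists k, `[< has_width G k >]) is left h then ex_minn h else 0.

(* Main.v *)
Require Import Defs.
From mathcomp Require Import all_boot.
From mathcomp Require Import boolp zify.

Set Implicit Arguments.
Unset Strict Implicit.
Unset Printing Implicit Defensive.

(** In a 3-connected graph, every vertex set [A] with [#|A|, #|~: A| >= 3]
    satisfies [mm A >= 3]: deleting at most two vertices always leaves an edge
    across the cut, and these edges make a matching of size at most two
    augmentable. Any branch-decomposition of at least 7 vertices has such a
    side: among the tree edges [xy] oriented so that the side of [x] has at
    least 3 elements, take one whose component at [x] is smallest; [x] then has
    two further branches with at most 2 leaves each, so the side of [x] has at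
    most 4 elements and its complement at least 3. Finally, since [mmw] is 0 in
    the absence of branch-decompositions, one is exhibited, on a caterpillar. *)

(** * Matchings across a cut *)

(** Each edge [[set f i; g i]] has [f i] as its only end in [A], hence lies in the cut; injectivity
    of [f] and [g] makes these edges pairwise disjoint. *)
Lemma leq_mm (G : sgraph) (A : {set G}) (I : finType) (f g : I -> G) :
  injective f -> injective g -> (forall i, f i \in A) ->
  (forall i, g i \notin A) -> (forall i, adj (f i) (g i)) -> #|I| <= mm A.
Proof.
move=> fI gI fA gA fg.
have sep i j : f i != g j.
  by apply: contraTneq (fA i) => ->; exact: gA.
pose e i := [set f i; g i].
have eI : injective e.
  move=> i j eij; have: f i \in e j by rewrite -eij !inE eqxx.
  by rewrite !inE (negPf (sep _ _)) orbF => /eqP /fI.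
have -> : #|I| = #|[set e i | i : I]| by rewrite card_imset ?cardsT.
rewrite /mm.
apply: (bigmax_sup [set e i | i : I]) => //.
apply/andP; split.
  apply/subsetP => _ /imsetP[i _ ->]; rewrite inE; apply/andP; split.
    by rewrite inE; apply/existsP; exists (f i); apply/existsP; exists (g i);
      rewrite fg eqxx.
  suff -> : e i :&: A = [set f i] by rewrite cards1.
  apply/setP => x; rewrite !inE.
  case: (eqVneq x (f i)) => [->|_] /=; first by rewrite fA.
  by case: (eqVneq x (g i)) => [->|] //=; rewrite (negPf (gA i)).
apply/trivIsetP => _ _ /imsetP[i _ ->] /imsetP[j _ ->] nij.
have {}nij : i != j by apply: contraNneq nij => ->.
rewrite -setI_eq0; apply/eqP/setP => x; rewrite !inE.
apply/negP => /andP[/orP[]/eqP-> /orP[]]; last 1 first.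
- by rewrite (inj_eq gI) (negPf nij).
- by rewrite (inj_eq fI) (negPf nij).
- by rewrite (negPf (sep _ _)).
- by rewrite eq_sym (negPf (sep _ _)).
Qed.

Lemma leq_mm3 (G : sgraph) (A : {set G}) (a1 a2 a3 b1 b2 b3 : G) :
  uniq [:: a1; a2; a3] -> uniq [:: b1; b2; b3] ->
  [/\ a1 \in A, a2 \in A & a3 \in A] ->
  [/\ b1 \notin A, b2 \notin A & b3 \notin A] ->
  [/\ adj a1 b1, adj a2 b2 & adj a3 b3] -> 3 <= mm A.
Proof.
move=> Ua Ub [A1 A2 A3] [B1 B2 B3] [E1 E2 E3].
pose f (i : 'I_3) := nth a1 [:: a1; a2; a3] i.
pose g (i : 'I_3) := nth b1 [:: b1; b2; b3] i.
have := @leq_mm G A 'I_3 f g; rewrite card_ord; apply.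
- by move=> i j /eqP; rewrite nth_uniq // => /eqP /val_inj.
- by move=> i j /eqP; rewrite nth_uniq // => /eqP /val_inj.
- by case=> [[|[|[|]]]].
- by case=> [[|[|[|]]]].
- by case=> [[|[|[|]]]].
Qed.

(** Otherwise the part of [A] outside [S] would be closed under adjacency in the connected graph
    left by deleting [S], although by cardinality both [A] and [~: A] have vertices outside [S]. *)
Lemma k_connected_cross (k : nat) (G : sgraph) (A S : {set G}) :
  k_connected k G -> #|S| < k -> #|S| < #|A| -> #|S| < #|~: A| ->
  exists a b, [/\ a \in A, a \notin S, b \notin A, b \notin S & adj a b].
Proof.
move=> [_ /(_ S) conS] ltSk ltSA ltSB; have {conS} [_ conS] := conS ltSk.
have ex (B : {set G}) : #|S| < #|B| -> exists2 x, x \in B & x \notin S.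
  move=> ltSB'; apply/subsetPn; apply: contraL ltSB' => /subset_leq_card.
  by rewrite -leqNgt.
have [a aA aS] := ex _ ltSA; have [b] := ex _ ltSB; rewrite inE => bA bS.
apply: contrapT => none.
pose P : pred (del_vertices S) := [pred x | val x \in A].
have clP : closed (@adj (del_vertices S)) P.
  apply: (intro_closed (e := @adj (del_vertices S))).
    by apply: sym_connect_sym; apply: adj_sym.
  move=> x y xy xA; apply: contrapT => /negP yA; apply: none.
  by exists (val x), (val y); split=> //; [exact: (valP x) | exact: (valP y)].
have := closed_connect clP (conS (Sub a aS) (Sub b bS)).
by rewrite !inE /= aA (negPf bA).
Qed.

Section ThreeConnected.
Variables (G : sgraph) (A : {set G}).
Hypotheses (G3 : k_connected 3 G) (A3 : 2 < #|A|) (B3 : 2 < #|~: A|).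

Let cross2 (x y : G) :
  exists a b, [/\ a \in A, b \notin A, adj a b,
                  (a != x) && (a != y) & (b != x) && (b != y)].
Proof.
have le2 : #|[set x; y]| <= 2 by rewrite cards2; case: (_ == _).
have [a [b [aA aS bA bS ab]]] := k_connected_cross G3 (le2 : _ < 3)
  (leq_ltn_trans le2 A3) (leq_ltn_trans le2 B3).
by exists a, b; move: aS bS; rewrite !inE !negb_or.
Qed.

(** Augmentation of the matching [a1 b1], [a2 b2], given a new neighbour [b] of [a1] and an edge
    from a new vertex [a']. If [b' = b1], the path [a' b1 a1 b] is augmenting. *)
Let augment (a1 a2 b1 b2 b a' b' : G) :
  [/\ a1 \in A, a2 \in A, b1 \notin A & b2 \notin A] ->
  a1 != a2 -> b1 != b2 -> adj a1 b1 -> adj a2 b2 ->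
  b \notin A -> b != b1 -> b != b2 -> adj a1 b ->
  a' \in A -> a' != a1 -> a' != a2 -> b' \notin A -> adj a' b' ->
  2 < mm A.
Proof.
move=> [A1 A2 B1 B2] a12 b12 e1 e2 bB nb1 nb2 ab aA na1 na2 bB' ab'.
case: (eqVneq b' b1) => [bE|nb1'].
  subst b'; apply: (@leq_mm3 G A a' a1 a2 b1 b b2) => //=;
    by rewrite !inE ?negb_or; do ?[apply/andP; split] => //; rewrite eq_sym.
case: (eqVneq b' b2) => [bE|nb2']; last first.
  apply: (@leq_mm3 G A a' a1 a2 b' b1 b2) => //=;
    by rewrite !inE ?negb_or; do ?[apply/andP; split] => //; rewrite eq_sym.
(* Now [a1] and [b2] cover all four edges at hand, so a crossing edge avoiding both is required. *)
subst b'; have [c [d [cA dB cd /andP[nc1 _] /andP[_ nd2]]]] := cross2 a1 b2.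
case: (eqVneq c a2) => [cE|nc2]; [subst c | ];
  case: (eqVneq d b1) => [dE|nd1]; try subst d.
- apply: (@leq_mm3 G A a' a2 a1 b2 b1 b) => //=;
    by rewrite !inE ?negb_or; do ?[apply/andP; split] => //; rewrite eq_sym.
- apply: (@leq_mm3 G A a' a2 a1 b2 d b1) => //=;
    by rewrite !inE ?negb_or; do ?[apply/andP; split] => //; rewrite eq_sym.
- apply: (@leq_mm3 G A c a1 a2 b1 b b2) => //=;
    by rewrite !inE ?negb_or; do ?[apply/andP; split] => //; rewrite eq_sym.
- apply: (@leq_mm3 G A c a1 a2 d b1 b2) => //=;
    by rewrite !inE ?negb_or; do ?[apply/andP; split] => //; rewrite eq_sym.
Qed.

Lemma mm_3_connected : 2 < mm A.
Proof.
have [x xA] : exists x, x \in A by apply/card_gt0P; lia.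
have [a1 [b1 [A1 B1 e1 _ _]]] := cross2 x x.
(* The second edge is disjoint from the first, the third has a new end outside [A], the fourth a new
   end in [A]. If the third has both ends new, it completes the matching. *)
have [a2 [b2 [A2 B2 e2 /andP[na _] /andP[_ nb]]]] := cross2 a1 b1.
have [a [b [aA bB ab _ /andP[nb1 nb2]]]] := cross2 b1 b2.
have [a' [b' [aA' bB' ab' /andP[na1 na2] _]]] := cross2 a1 a2.
have na' : a1 != a2 by rewrite eq_sym.
have nb' : b1 != b2 by rewrite eq_sym.
case: (eqVneq a a1) => [aE|n1]; first subst a.
  by apply: (@augment a1 a2 b1 b2 b a' b').
case: (eqVneq a a2) => [aE|n2]; first subst a.
  by apply: (@augment a2 a1 b2 b1 b a' b').
apply: (@leq_mm3 G A a a1 a2 b b1 b2) => //=;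
  by rewrite !inE ?negb_or; do ?[apply/andP; split].
Qed.

End ThreeConnected.

(** * Balanced edges of subcubic trees *)

Section Branch.
Variable T : sgraph.

Definition branch (x y : T) : {set T} := [set z | connect (del_edge x y) x z].

Lemma branch_root x y : x \in branch x y.
Proof. by rewrite inE connect0. Qed.

Lemma branch_adj x y z w :
  z \in branch x y -> adj z w -> w \in branch x y \/ [set z; w] = [set x; y].
Proof.
rewrite !inE => xz zw; case: (eqVneq [set z; w] [set x; y]); first by right.
by move=> nzw; left; apply: connect_trans xz (connect1 _); apply/andP.
Qed.

Lemma eq_set2_cases (z w x y : T) :
  [set z; w] = [set x; y] -> (z = x \/ z = y) /\ (w = x \/ w = y).
Proof.
by move=> E; split; apply/set2P; rewrite -E !inE eqxx ?orbT.
Qed.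

Lemma branch_min (P : pred T) x y :
  P x -> (forall z w, P z -> del_edge x y z w -> P w) ->
  {subset branch x y <= P}.
Proof.
move=> Px clP z; rewrite inE => /connectP[p].
suff: forall u, P u -> path (del_edge x y) u p -> z = last u p -> P z by exact.
elim: p => [|w p IHp] u Pu /=; first by move=> _ ->.
by case/andP=> /(clP _ _ Pu) Pw; exact: IHp.
Qed.

(** A walk from [x] can leave a branch only through the edge [xy], whose ends both lie in the
    union. *)
Lemma branch_cover x y :
  connected_graph T -> branch x y :|: branch y x = setT.
Proof.
case=> _ conT; apply/setP => z; rewrite [RHS]inE.
have /connectP[p] := conT x z.
suff: forall u, u \in branch x y :|: branch y x -> path (@adj T) u p ->
    z = last u p -> z \in branch x y :|: branch y x.
  by apply; rewrite in_setU branch_root.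
elim: p => [|w p IHp] u uU /=; first by move=> _ ->.
case/andP=> uw; apply: IHp; move: uU; rewrite !in_setU.
have rx := branch_root x y; have ry := branch_root y x.
by case/orP=> /branch_adj-/(_ _ uw)[->|/eq_set2_cases[_ [->|->]]];
  rewrite ?rx ?ry ?orbT.
Qed.

Hypothesis acT : acyclic T.

(** Otherwise a duplicate-free path from [x] to [y] avoiding the edge [xy] would close up with it to
    a cycle of at least three vertices. *)
Lemma branch_acyclic x y : adj x y -> y \notin branch x y.
Proof.
move=> xy; apply/negP; rewrite inE => /connectP[p0 p0P].
case/shortenP: p0P => p pP Up _ yE.
have subT : subrel (del_edge x y) (@adj T) by move=> u v /andP[].
have pT := sub_path subT pP.
have: size (x :: p) <= 2.
  by apply: acT; rewrite /ucycle /= rcons_path pT -yE adj_sym xy.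
case: p pP Up yE {pT} => [|u [|//]] /=.
  by move=> _ _ yE; move: xy; rewrite yE adj_irrefl.
by move=> + _ yE; rewrite andbT => /andP[_]; rewrite -yE eqxx.
Qed.

(** Moving the edge one step past [x] loses [x] itself; this strict decrease is what a minimal
    choice of edge exploits. *)
Lemma branch_proper x y u :
  adj x y -> adj x u -> u != y -> branch u x \proper branch x y.
Proof.
move=> xy xu uy; have ux : adj u x by rewrite adj_sym.
have xNu := branch_acyclic ux; have yNx := branch_acyclic xy.
apply/properP; split; last by exists x; first exact: branch_root.
(* With [branch u x] carried in the invariant, the edge [xy] cannot be crossed: [x] is outside
   [branch u x] and [y] outside [branch x y]. *)
suff sub : {subset branch u x <= [pred z in branch x y | z \in branch u x]}.
  by apply/subsetP => z /sub /andP[].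
apply: branch_min => [|z w /andP[zx zu] /andP[zw nzw]] /=.
  rewrite !inE connect0 andbT; apply: connect1; apply/andP; split=> //.
  by apply: contraNneq uy => /eq_set2_cases[_ [E|->//]];
    move: xu; rewrite E adj_irrefl.
have wu : w \in branch u x.
  by case: (branch_adj zu zw) => // E; rewrite E eqxx in nzw.
apply/andP; split=> //.
case: (branch_adj zx zw) => // /eq_set2_cases[[E|E] _].
  by rewrite E (negPf xNu) in zu.
by rewrite E (negPf yNx) in zx.
Qed.

End Branch.

Section Balanced.
Variables (G : sgraph) (D : branch_decomposition G).
Let T := bd_tree D.

Lemma sideE (x y : T) :
  side x y = [set bd_map l | l : leaf T & val l \in branch x y].
Proof.
by apply/setP => v; apply/imsetP/imsetP => -[l lP ->]; exists l;
  rewrite // !inE in lP *.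
Qed.

Lemma side_cover (x y : T) : side x y :|: side y x = setT.
Proof.
have [conT _] := bd_is_tree D; have [g _ fg] := bd_map_bij D.
apply/setP => v; rewrite !sideE in_setU [RHS]inE -(fg v).
have := in_setT (val (g v)); rewrite -(branch_cover x y conT) in_setU.
by case/orP=> H; apply/orP; [left|right]; apply: imset_f; rewrite inE.
Qed.

(** The only edge at the leaf [x] is the deleted one, so its branch is [x] alone. *)
Lemma side_leaf (x y : T) : adj x y -> degree x = 1 -> #|side x y| <= 1.
Proof.
move=> xy /eqP/cards1P[y' Ny].
have y'E : y' = y by apply/esym/set1P; rewrite -Ny inE.
have sub : {subset branch x y <= pred1 x}.
  apply: branch_min => [|z w /eqP-> /andP[xw]]; first exact: eqxx.
  have: w \in [set y'] by rewrite -Ny inE.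
  by rewrite y'E => /set1P->; rewrite eqxx.
rewrite sideE; apply/card_le1_eqP => _ _ /imsetP[l1 + ->] /imsetP[l2 + ->].
rewrite inE => /sub/eqP l1x; rewrite inE => /sub/eqP l2x.
by congr bd_map; apply: val_inj; rewrite l1x l2x.
Qed.

(** Having degree 3, [x] carries no vertex of [G], and a walk leaving [x] without the edge [xy]
    enters the branch of one of the other two neighbours. *)
Lemma side_split (x y : T) : adj x y -> degree x = 3 ->
  exists u v, [/\ adj x u, adj x v, u != y, v != y &
                  side x y \subset side u x :|: side v x].
Proof.
move=> xy d3; pose N := [set z | adj x z].
have: #|N :\ y| == 2.
  by move: d3; rewrite /degree (cardsD1 y) inE xy add1n => -[->].
case/cards2P => u [v [_ NE]]; exists u, v.
have: u \in N :\ y by rewrite NE set21.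
have: v \in N :\ y by rewrite NE set22.
rewrite !inE => /andP[vy xv] /andP[uy xu].
split=> //.
have sub : {subset branch x y <=
              [pred z | [|| z == x, z \in branch u x | z \in branch v x]]}.
  have ru := branch_root u x; have rv := branch_root v x.
  apply: branch_min => [|z w zP /andP[zw nzw]]; first by rewrite /= eqxx.
  case/or3P: zP => [/eqP zx|zu|zv] /=; last 2 first.
  - by case: (branch_adj zu zw) => [->|/eq_set2_cases[_ [->|->]]];
      rewrite ?ru ?rv ?eqxx ?orbT.
  - by case: (branch_adj zv zw) => [->|/eq_set2_cases[_ [->|->]]];
      rewrite ?ru ?rv ?eqxx ?orbT.
  - have: w \in N :\ y.
      rewrite !inE -zx zw andbT; apply: contraNneq nzw => ->.
      by rewrite zx.
    by rewrite NE => /set2P[->|->]; rewrite ?ru ?rv ?orbT.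
rewrite !sideE; apply/subsetP => _ /imsetP[l + ->].
rewrite inE => /sub /or3P[/eqP lx|lu|lv]; rewrite in_setU.
- by have := valP l; rewrite /= lx d3.
- by apply/orP; left; apply: imset_f; rewrite inE.
- by apply/orP; right; apply: imset_f; rewrite inE.
Qed.

Lemma balanced_edge : 7 <= #|G| ->
  exists x y : T, [/\ adj x y, 2 < #|side x y| & 2 < #|~: side x y|].
Proof.
move=> G7; have [_ acT] := bd_is_tree D.
pose P (p : T * T) := adj p.1 p.2 && (2 < #|side p.1 p.2|).
have [p0 p0P] : exists p, P p.
  have [v _] : exists v : G, v \in G by apply/card_gt0P/leq_trans/G7.
  have [g _ _] := bd_map_bij D.
  have /cards1P[y Ny] := valP (g v); set x := val (g v) in Ny.
  have xy : adj x y by have := set11 y; rewrite -Ny inE.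
  (* The two sides at an arbitrary leaf edge cover at least 7 vertices, so one orientation of that
     edge satisfies [P]. *)
  have := leq_card_setU (side x y) (side y x).
  rewrite side_cover cardsT => /(leq_trans G7) le7.
  have [lt2|le2] := ltnP 2 #|side x y|.
    by exists (x, y); rewrite /P /= xy.
  by exists (y, x); rewrite /P /= adj_sym xy; lia.
case: (arg_minnP (fun p : T * T => #|branch p.1 p.2|) p0P).
case=> x y /andP[/= xy lt2] minxy; exists x, y; split=> //.
case: (bd_subcubic x) => [/(side_leaf xy)|]; first lia.
case/(side_split xy)=> u [v [xu xv uy vy /subset_leq_card le_uv]].
have small w : adj x w -> w != y -> #|side w x| <= 2.
  move=> xw wy; rewrite leqNgt; apply/negP => lt2w.
  have /proper_card := branch_proper acT xy xw wy.
  by rewrite ltnNge (minxy (w, x)) // /P /= adj_sym xw.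
have le4 : #|side x y| <= 4.
  apply: leq_trans le_uv (leq_trans (leq_card_setU _ _) _).
  exact: leq_add (small u xu uy) (small v xv vy).
(* Since [7 = 4 + 3], a side of at most 4 elements leaves at least 3 outside. *)
rewrite -(leq_add2l 4); apply: leq_trans (leq_add le4 (leqnn _)).
by rewrite cardsC.
Qed.

End Balanced.

Lemma width_ge3 (G : sgraph) (D : branch_decomposition G) :
  k_connected 3 G -> 7 <= #|G| -> 3 <= width D.
Proof.
move=> G3 /(@balanced_edge G D)[x [y [xy A3 B3]]].
apply: (bigmax_sup x) => //; apply: (bigmax_sup y) => //.
exact: mm_3_connected.
Qed.

(** * Trees given by a parent function *)

Section ParentTree.
Variables (N : nat) (p : nat -> nat).
Hypothesis p_lt : forall i, 0 < i -> p i < i.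

(** The comparisons discard the value [p 0], so that the root 0 has no parent. *)
Definition parent_adj (i j : 'I_N.+1) : bool :=
  (i < j) && (p j == i) || (j < i) && (p i == j).

Lemma parent_adj_sym : symmetric parent_adj.
Proof. by move=> i j; rewrite /parent_adj orbC. Qed.

Lemma parent_adj_irrefl : irreflexive parent_adj.
Proof. by move=> i; rewrite /parent_adj ltnn. Qed.

Definition parent_graph : sgraph := SGraph parent_adj_sym parent_adj_irrefl.

(* The largest vertex of a cycle would have two distinct parents. *)
Lemma parent_graph_is_tree : is_tree parent_graph.
Proof.
split; first split; first by rewrite card_ord.
  (* Strong induction along parents joins the root 0 to every vertex. *)
  have con0 (i : 'I_N.+1) : connect parent_adj ord0 i.
    have [n] := ubnP (i : nat); elim: n i => // n IHn i lt_in.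
    have [i0|i_gt0] := posnP i.
      by rewrite (_ : i = ord0) ?connect0 //; apply: val_inj.
    have pi := p_lt i_gt0; pose j : 'I_N.+1 := inord (p i).
    have jE : j = p i :> nat by rewrite inordK // (ltn_trans pi).
    apply: connect_trans (IHn j _) (connect1 _); first by rewrite jE; lia.
    by rewrite /parent_adj jE pi eqxx.
  move=> x y; apply: connect_trans (con0 y).
  by rewrite (sym_connect_sym parent_adj_sym) con0.
move=> s; case: s => // x0 s0; set s := x0 :: s0 => cs.
case: (arg_maxnP (P := [in s]) (fun i : 'I_N.+1 => i : nat)
         (mem_head x0 s0 : x0 \in s)) => m ms maxm.
(* Rotated to start at its maximum [m], the cycle has the neighbours of [m] as its second and last
   vertices, [y] and [w] below. *)
have [i s' rs] := rot_to ms.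
have: ucycle parent_adj (m :: s') by rewrite -rs rot_ucycle.
rewrite -(size_rot i s) rs.
have up z : z \in m :: s' -> parent_adj m z -> p m = z.
  rewrite -rs mem_rot => /maxm le_zm /orP[|] /andP[lt /eqP //].
  by move: (leq_ltn_trans le_zm lt); rewrite ltnn.
case: s' rs up => [|y [|z t]] // _ up; set w := last z t.
have wt : w \in z :: t by rewrite mem_last.
case/andP; rewrite /cycle rcons_path => /andP[/andP[my _] wm].
case/and3P=> _ ny _; case/negP: ny.
have yE := up y (mem_nth m (isT : 1 < size (m :: y :: z :: t))) my.
have wE : p m = w.
  apply: up; last by rewrite parent_adj_sym.
  by rewrite 2!in_cons wt !orbT.
have -> : y = w by apply/ord_inj; rewrite -yE -wE.
exact: wt.
Qed.

End ParentTree.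

(* Vertex 0 is a leaf attached to 1, and every odd vertex [i] has the children
   [i.+1] and [i.+2]: the spine consists of the odd vertices. *)
Definition caterpillar_parent (i : nat) : nat := if odd i then i - 2 else i - 1.

(** The indices run from 0 to the odd number [2k + 1], so the last spine vertex has no children and
    is a leaf. *)
Definition caterpillar (k : nat) : sgraph :=
  parent_graph k.*2.+1 caterpillar_parent.

Lemma caterpillar_is_tree k : is_tree (caterpillar k).
Proof.
apply: parent_graph_is_tree => i.
by rewrite /caterpillar_parent; case: ifP; lia.
Qed.

Lemma caterpillar_degree k (x : 'I_k.*2.+2) :
  @degree (caterpillar k) x =
    if ~~ odd x || (x == k.*2.+1 :> nat) then 1 else 3.
Proof.
rewrite /degree; have xk := ltn_ord x.
case: ifP => lx.
  (* The unique neighbour of a leaf is its parent, except that the root 0 has its child 1. *)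
  pose n := if x == 0 :> nat then 1 else caterpillar_parent x.
  have nk : n < k.*2.+2 by rewrite /n /caterpillar_parent; do ?case: ifP; lia.
  rewrite (_ : [set y | _] = [set inord n]) ?cards1 //.
  apply/setP => y; rewrite !inE -val_eqE /= inordK // /parent_adj /n.
  rewrite /caterpillar_parent; have yk := ltn_ord y.
  by do ?case: ifP; lia.
pose n := caterpillar_parent x.
have nk : n < k.*2.+2 by rewrite /n /caterpillar_parent; do ?case: ifP; lia.
rewrite (_ : [set y | _] = [set inord n; inord x.+1; inord x.+2]).
  rewrite -!setUA !cardsU1 !inE cards1 -!val_eqE /= !inordK ?/n //; try lia.
  by rewrite /caterpillar_parent; do ?case: ifP; lia.
apply/setP => y; rewrite !inE -!val_eqE /= !inordK // /parent_adj /n; try lia.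
rewrite /caterpillar_parent; have yk := ltn_ord y.
by do ?case: ifP; lia.
Qed.

(** The leaves are the [k + 1] even vertices and the last vertex, which is split off from the
    sum. *)
Lemma card_caterpillar_leaf k : #|leaf (caterpillar k)| = k.+2.
Proof.
rewrite card_sig; set P := (X in #|X|).
pose Q := [pred x : 'I_k.*2.+2 | ~~ odd x || (x == k.*2.+1 :> nat)].
rewrite (@eq_card _ _ Q).
  rewrite -sum1_card big_mkcond big_ord_recr !inE /= eqxx orbT addn1.
  congr _.+1.
  have: \sum_(i < k.*2.+1) ~~ odd i = k.+1.
    elim: k {P Q} => [|k IHk]; first by rewrite big_ord_recl big_ord0.
    rewrite doubleS !big_ord_recr /= in IHk *.
    by rewrite IHk odd_double /= addn0 addn1.
  move=> <-; apply: eq_bigr => i _ /=.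
  by rewrite inE /= (ltn_eqF (ltn_ord i)) orbF; case: (odd i).
by move=> x; rewrite !inE caterpillar_degree; case: ifP.
Qed.

Lemma branch_decomposition_exists (G : sgraph) :
  1 < #|G| -> inhabited (branch_decomposition G).
Proof.
(* This [k] makes the [k + 2] leaves of the caterpillar equinumerous with [G]; any bijection then
   serves as labelling. *)
move=> G2; pose k := #|G| - 2.
have cardG : #|leaf (caterpillar k)| = #|G|.
  by rewrite card_caterpillar_leaf /k -addn2 subnK.
pose f (l : leaf (caterpillar k)) : G :=
  enum_val (cast_ord cardG (enum_rank l)).
have f_bij : bijective f.
  apply: inj_card_bij; last by rewrite cardG.
  by move=> l1 l2 /enum_val_inj /cast_ord_inj /enum_rank_inj.
have cubic : subcubic (caterpillar k).
  by move=> x; rewrite caterpillar_degree; case: ifP; [left | right].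
exact (inhabits (BranchDecomposition (caterpillar_is_tree k) cubic f_bij)).
Qed.

Theorem lemma3p1 (G : sgraph) (G3 : k_connected 3 G) (G7 : 7 <= #|G|) :
  3 <= mmw G.
Proof.
rewrite /mmw; case: pselect => [h|[]].
  case: ex_minnP => n /asboolP[D <-] _; exact: width_ge3.
have [D] := branch_decomposition_exists (leq_trans (isT : 1 < 7) G7).
by exists (width D); apply/asboolP; exists D.
Qed.
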